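(* Let $m\ge 1$. For every $F\in\mathsf{For}^{\underline{m}}$ and every $i\ge 1$, $$\mathsf{T}_i^{\underline{m}}\,\mathfrak{P}_F^{\underline{m}}=\begin{cases}\mathfrak{P}_{F/i}^{\underline{m}}&\text{if }i\in\mathrm{LTer}(F),\\0&\text{otherwise.}\end{cases}$$
   Context: $\mathbb{N}=\{1,2,\ldots\}$, $\mathrm{Pol}=\mathbb{Z}[x_1,x_2,\ldots]$. For $i\ge 1$, $\mathsf{R}_i(f)=f(x_1,\ldots,x_{i-1},0,x_i,x_{i+1},\ldots)$, and $\mathsf{R}_i^m$ is its $m$-fold composite, i.e. $\mathsf{R}_i^m(f)=f(x_1,\ldots,x_{i-1},0,\ldots,0,x_i,x_{i+1},\ldots)$ with $m$ zeros. Define $\mathsf{T}_i^{\underline{m}}(f)=\dfrac{\mathsf{R}_{i+1}^m(f)-\mathsf{R}_i^m(f)}{x_i}$ for $f\in\mathrm{Pol}$ (always a polynomial). Forests: an $(m+1)$-ary tree is a finite rooted plane tree in which each node is either a leaf (no children) or internal, having exactly $m+1$ ordered children $v_0,\ldots,v_m$; $\ast$ is the tree with a single node (a leaf). An $m$-indexed forest is an infinite sequence $F=(T_1,T_2,\ldots)$ of $(m+1)$-ary trees, all but finitely many equal to $\ast$; $\mathsf{For}^{\underline{m}}$ is the set of these. The leaves of $F$, read from left to right, are identified with $1,2,3,\ldots$. $\mathrm{IN}(F)$ is the finite set of internal nodes. For $v\in\mathrm{IN}(F)$, $\rho_F(v)\in\mathbb{N}$ is the leaf reached from $v$ by repeatedly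 passing to the leftmost child $v_0$. A node $v\in\mathrm{IN}(F)$ is terminal if all its children are leaves; $\mathrm{LTer}(F)=\{\rho_F(v):v\text{ terminal}\}$. If $i\in\mathrm{LTer}(F)$, $F/i$ is obtained by deleting the $m+1$ leaf children of the terminal node $v$ with $\rho_F(v)=i$, so that $v$ becomes a leaf (leaves are then relabelled from left to right). $m$-forest polynomials: let $\mathcal{C}(F)$ be the set of $\kappa:\mathrm{IN}(F)\to\mathbb{N}$ such that for all $v\in\mathrm{IN}(F)$: $\kappa(v)\le\rho_F(v)$; $\kappa(v)\le\kappa(v_j)-j$ for every $0\le j\le m$ with $v_j\in\mathrm{IN}(F)$; and $\kappa(v)\equiv\rho_F(v)\pmod m$. Then $\mathfrak{P}_F^{\underline{m}}=\sum_{\kappa\in\mathcal{C}(F)}\prod_{v\in\mathrm{IN}(F)}x_{\kappa(v)}$. *)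

(* Defs.v *)
From HB Require Import structures.
From mathcomp Require Import all_boot all_algebra.
From mathcomp Require Import finmap ring zify.
From mathcomp.multinomials Require Import monalg.

Set Implicit Arguments.
Unset Strict Implicit.
Unset Printing Implicit Defensive.

Import GRing.Theory.
Local Open Scope fset_scope.
Local Open Scope ring_scope.

(* Convention: the set {1, 2, 3, ...} is represented by [nat] through          *)
(* n |-> n - 1, for all its uses at once: the variables x_1, x_2, ... are      *)
(* [X 0], [X 1], ..., the trees T_1, T_2, ... of a forest F are [F 0],         *)
(* [F 1], ..., its leaves are 0, 1, ..., and the values of kappa, the elements *)
(* of LTer(F) and the index i of R_i, T_i and F/i are shifted in the same way. *)
(* The conditions defining C(F) (comparisons, translations by j, congruences   *)
(* mod m) are invariant under this common shift.                               *)

Lemma mod_sub (A : comNzRingType) (a b p g : A) :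
  a = b + p * g -> p * g == a - b.
Proof. by move=> ->; rewrite addrC addKr. Qed.

Notation pol := {malg int[{cmonom nat}]}.

Lemma malgCUM (K : monomType) (A : nzRingType) (c : A) (k : K) :
  c%:MP * << k >> = << c *g k >>.
Proof.
by rewrite mul_malgC; apply/malgP => k'; rewrite mcoeffZ !mcoeffU mulr_natr.
Qed.

Lemma mcoeffUM (K : monomType) (A : nzRingType) (k k' : K) (g : {malg A[K]}) :
  injective (mmul k) -> (<< k >> * g)@_(mmul k k') = g@_k'.
Proof.
move=> k_inj; rewrite malgM_def fgmulUg {3}[g]monalgE !raddf_sum /=.
by apply: eq_bigr => j _; rewrite !mcoeffU mul1r (inj_eq k_inj).
Qed.

Lemma mod_mul (A : comNzRingType) (b p g d h : A) :
  (b + p * g) * (d + p * h) = b * d + p * (g * d + b * h + g * (p * h)).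
Proof. by ring. Qed.

(* [X i] is the variable x_{i+1}. *)
Definition X (i : nat) : pol := << ucm i >>.

Lemma X_inj i : injective ( *%R (X i)).
Proof.
have mul_inj : injective (mulcm (ucm i)).
  move=> k1 k2 /eqP /cmP e; apply/eqP/cmP => j.
  by move/eqP: (e j); rewrite !mulcmE eqn_add2l => /eqP.
move=> f g fg; apply/malgP => k.
rewrite -(mcoeffUM k f mul_inj) -(mcoeffUM k g mul_inj).
exact: (f_equal (fun h : pol => h@_(mulcm (ucm i) k)) fg).
Qed.

Section Substitution.
Variable s : nat -> pol.

Definition monsubst (k : {cmonom nat}) : pol :=
  \prod_(j <- finsupp k) s j ^+ k j.

(* The polynomial f(s 0, s 1, s 2, ...) *)
Definition psubst (f : pol) : pol :=
  mmap (@malgC {cmonom nat} int) monsubst f.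

Lemma monsubstEw (d : {fset nat}) (k : {cmonom nat}) :
  finsupp k `<=` d -> monsubst k = \prod_(j <- d) s j ^+ k j.
Proof.
move=> le; rewrite /monsubst (big_fset_incl _ le) //= => j _.
by rewrite -cmE_eq0 => /eqP ->; rewrite expr0.
Qed.

Lemma monsubst_is_multiplicative : mmorphism monsubst.
Proof.
split=> [m1 m2|]; last by rewrite /monsubst mdom1 big_seq_fset0.
rewrite (@monsubstEw (finsupp m1 `|` finsupp m2)) ?mdomD //.
rewrite (@monsubstEw (finsupp m1 `|` finsupp m2) m1) ?fsubsetUl //.
rewrite (@monsubstEw (finsupp m1 `|` finsupp m2) m2) ?fsubsetUr //.
by rewrite -big_split /=; apply: eq_bigr => j _; rewrite cmM exprD.
Qed.

HB.instance Definition _ :=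
  isMultiplicative.Build {cmonom nat} pol monsubst monsubst_is_multiplicative.

HB.instance Definition _ :=
  GRing.RMorphism.copy psubst (mmap (@malgC {cmonom nat} int) monsubst).

Lemma psubstX i : psubst (X i) = s i.
Proof.
by rewrite /psubst mmapU /= mpolyC1E mul1r /monsubst mdomU big_seq_fset1 cmUU.
Qed.

Lemma psubstC (c : int) : psubst c%:MP = c%:MP.
Proof. by rewrite /psubst mmapC. Qed.

End Substitution.

Lemma psubstE (s : nat -> pol) (f : pol) :
  psubst s f = \sum_(k <- msupp f) (f@_k)%:MP * monsubst s k.
Proof. by []. Qed.

Lemma monsubst_id (k : {cmonom nat}) : monsubst X k = << k >>.
Proof.
have [n] := ubnP (mdeg k); elim: n k => // n IHn k; rewrite ltnS => le_kn.
have [k0|/fset0Pn [i ik]] := eqVneq (finsupp k) fset0.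
  suff -> : k = onecm nat by rewrite mmorph1.
  by apply: mdeg_eq0I; rewrite mdegE k0 big_seq_fset0.
have kE : k = mulcm (ucm i) (divcm k (ucm i)).
  apply/eqP/cmP => j; rewrite mulcmE divcmE ucmE subnKC //.
  by case: eqVneq => // <-; rewrite lt0n cmE_neq0.
have ltd : (mdeg (divcm k (ucm i)) < n)%N.
  by apply: leq_trans le_kn; rewrite {2}kE mdegM mdegU.
have -> : << k >> = << ucm i >> * << divcm k (ucm i) >> :> pol.
  by rewrite {1}kE malgM_def fgmulUU mulr1.
rewrite {1}kE (monsubst_is_multiplicative X).1 (IHn _ ltd).
by rewrite {1}/monsubst mdomU big_seq_fset1 cmUU.
Qed.

Lemma psubst_id (f : pol) : psubst X f = f.
Proof.
rewrite {2}[f]monalgE psubstE; apply: eq_bigr => k _.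
by rewrite monsubst_id malgCUM.
Qed.

Lemma psubst_comp (s t : nat -> pol) (f : pol) :
  psubst s (psubst t f) = psubst (fun j => psubst s (t j)) f.
Proof.
rewrite [psubst t f]psubstE [RHS]psubstE rmorph_sum; apply: eq_bigr => k _.
rewrite rmorphM /= psubstC rmorph_prod /=.
suff -> : monsubst (fun j => psubst s (t j)) k =
          \prod_(j <- finsupp k) psubst s (t j ^+ k j) by [].
by apply: eq_bigr => j _; rewrite rmorphXn.
Qed.

(* Keeps failing conversion tests below from unfolding polynomials. *)
#[local] Opaque psubst X.

(* f(x_1, ..., x_{i-1}, 0, x_i, x_{i+1}, ...) *)
Definition R (i : nat) : pol -> pol :=
  psubst (fun j => if (j < i)%N then X j else if j == i then 0 else X j.-1).

HB.instance Definition _ i := GRing.RMorphism.on (R i).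

Lemma RX i j :
  R i (X j) = if (j < i)%N then X j else if j == i then 0 else X j.-1.
Proof. by rewrite /R psubstX. Qed.

Lemma iter_RX m i j : iter m (R i) (X j) =
  if (j < i)%N then X j else if (j < i + m)%N then 0 else X (j - m).
Proof.
elim: m => [|m IHm] /=; first by rewrite addn0 subn0; case: (j < i)%N.
rewrite IHm addnS ltnS; case: ltnP => [ji|ij]; first by rewrite RX ji.
case: ltngtP => [jm|mj|->].
- by rewrite rmorph0.
- have ji : (j - m < i)%N = false by lia.
  have jni : (j - m == i)%N = false by lia.
  by rewrite RX ji jni subnS.
by rewrite addnK RX ltnn eqxx.
Qed.

Lemma iter_RE m i (f : pol) :
  iter m (R i) f = psubst (fun j => iter m (R i) (X j)) f.
Proof.
elim: m => [|m IHm]; first exact/esym/psubst_id.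
exact: etrans (congr1 (R i) IHm) (psubst_comp _ _ f).
Qed.

Lemma eq_psubst_mod (p : pol) (s t : nat -> pol) (f : pol) :
  (forall j, exists g, s j = t j + p * g) ->
  exists g, psubst s f = psubst t f + p * g.
Proof.
move=> st; pose E (a b : pol) := exists g, a = b + p * g.
have E0 a : E a a by exists 0; rewrite mulr0 addr0.
have ED a b c d : E a b -> E c d -> E (a + c) (b + d).
  by move=> [g ->] [h ->]; exists (g + h); rewrite mulrDr addrACA.
have EM a b c d : E a b -> E c d -> E (a * c) (b * d).
  move=> [g ->] [h ->]; exists (g * d + b * h + g * (p * h)).
  exact: mod_mul.
rewrite -/(E (psubst s f) (psubst t f)) !psubstE.
apply: (big_ind2 E); [exact: E0 | exact: ED | move=> k _].
apply: (EM _ _ _ _); first exact: E0.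
rewrite /monsubst; apply: (big_ind2 E); [exact: E0 | exact: EM | move=> j _].
elim: (k j) => [|n IHn]; first exact: E0.
by rewrite !exprS; apply: (EM _ _ _ _); first exact: st.
Qed.

Lemma iter_RX_mod m i j :
  exists g, iter m (R i.+1) (X j) = iter m (R i) (X j) + X i * g.
Proof.
suff [g e] : exists g,
    (if (j < i.+1)%N then X j else if (j < i.+1 + m)%N then 0 else X (j - m)) =
    (if (j < i)%N then X j else if (j < i + m)%N then 0 else X (j - m)) +
    X i * g.
  exists g; apply: (etrans (iter_RX m i.+1 j)); apply: (etrans e).
  by rewrite -(iter_RX m i j).
rewrite addSn !ltnS.
case: (ltngtP j i) => [ji|ij|->].
- by exists 0; rewrite mulr0 addr0.
- case: (ltngtP j (i + m)%N) => [jm|mj|->].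
  + by exists 0; rewrite mulr0 addr0.
  + by exists 0; rewrite mulr0 addr0.
  by exists (- 1); rewrite addnK mulrN1 subrr.
case: (posnP m) => [->|m_gt0].
  by exists 0; rewrite addn0 ltnn subn0 mulr0 addr0.
have -> : (i < i + m)%N by lia.
by exists 1; rewrite mulr1 add0r.
Qed.

Lemma T_subproof m i (f : pol) :
  exists g, X i * g == iter m (R i.+1) f - iter m (R i) f.
Proof.
have [g fg] := @eq_psubst_mod (X i) (fun j => iter m (R i.+1) (X j))
                 (fun j => iter m (R i) (X j)) f (iter_RX_mod m i).
exists g; apply: mod_sub; rewrite [LHS]iter_RE fg.
by rewrite [in RHS]iter_RE.
Qed.

(* The quotient of R_{i+1}^m(f) - R_i^m(f) by x_i, unique by [X_inj]. *)
Definition T m i (f : pol) : pol := xchoose (T_subproof m i f).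

Lemma TE m i (f : pol) : X i * T m i f = iter m (R i.+1) f - iter m (R i) f.
Proof. exact/eqP/(xchooseP (T_subproof m i f)). Qed.

(* (m+1)-ary trees *)
Inductive tree (m : nat) : predArgType :=
| leaf : tree m
| node : {ffun 'I_m.+1 -> tree m} -> tree m.
Arguments leaf {m}.

Section TreeInd.
Variables (m : nat) (P : tree m -> Prop).
Hypothesis Pleaf : P leaf.
Hypothesis Pnode : forall f : {ffun 'I_m.+1 -> tree m},
  (forall j, P (f j)) -> P (node f).

Fixpoint tree_induction (t : tree m) : P t :=
  match t with
  | leaf => Pleaf
  | node f => Pnode (fun j => tree_induction (f j))
  end.
End TreeInd.

Section TreeChoice.
Variable m : nat.

Fixpoint tree_encode (t : tree m) : GenTree.tree unit :=
  match t with
  | leaf => GenTree.Leaf tt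
  | node f => GenTree.Node 0 [seq tree_encode (f j) | j <- enum 'I_m.+1]
  end.

Fixpoint tree_decode (t : GenTree.tree unit) : tree m :=
  match t with
  | GenTree.Leaf _ => leaf
  | GenTree.Node _ s =>
      node [ffun j : 'I_m.+1 => nth leaf [seq tree_decode u | u <- s] j]
  end.

Lemma tree_encodeK : cancel tree_encode tree_decode.
Proof.
elim/tree_induction => //= f IHf; congr node; apply/ffunP => j.
by rewrite ffunE -map_comp (nth_map j) ?size_enum_ord //= nth_ord_enum IHf.
Qed.

HB.instance Definition _ := Choice.copy (tree m) (can_type tree_encodeK).
End TreeChoice.

Section Trees.
Variable m : nat.
Implicit Types (t : tree m) (p : seq 'I_m.+1).

(* Nodes of a tree are addressed by the sequence of child indices leading to  *)
(* them from the root.                                                        *)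
Fixpoint subtree t p : tree m :=
  match p, t with
  | [::], _ => t
  | j :: p', node f => subtree (f j) p'
  | _ :: _, leaf => leaf
  end.

(* Replaces the subtree at address p by a leaf. *)
Fixpoint cut t p : tree m :=
  match p, t with
  | [::], _ => leaf
  | j :: p', node f =>
      node [ffun k => if k == j then cut (f k) p' else f k]
  | _ :: _, leaf => leaf
  end.

(* The addresses of the leaves, from left to right. *)
Fixpoint leaves t : seq (seq 'I_m.+1) :=
  match t with
  | leaf => [:: [::]]
  | node f =>
      flatten [seq [seq j :: q | q <- leaves (f j)] | j <- enum 'I_m.+1]
  end.

Fixpoint inodes t : seq (seq 'I_m.+1) :=
  match t with
  | leaf => [::]
  | node f =>
      [::] :: flatten [seq [seq j :: q | q <- inodes (f j)] | j <- enum 'I_m.+1]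
  end.

(* The address of the leaf reached from the root through leftmost children. *)
Fixpoint leftmost t : seq 'I_m.+1 :=
  match t with
  | leaf => [::]
  | node f => ord0 :: leftmost (f ord0)
  end.
End Trees.

Definition forest (m : nat) := {fsfun nat -> tree m with leaf}.

Section Forests.
Variable m : nat.
Implicit Types F : forest m.

(* (k, p) is the node at address p of the tree [F k]. *)
Definition address : Type := nat * seq 'I_m.+1.

Definition child (v : address) (j : 'I_m.+1) : address := (v.1, rcons v.2 j).

Definition subforest F (v : address) : tree m := subtree (F v.1) v.2.

Definition IN F : {fset address} :=
  [fset ((k, p) : address) | k in finsupp F, p in inodes (F k)].

(* The position of the leaf v among all the leaves of F. *)
Definition leaf_label F (v : address) : nat :=
  (\sum_(k < v.1) size (leaves (F k)) + index v.2 (leaves (F v.1)))%N.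

Definition rho F (v : address) : nat :=
  leaf_label F (v.1, v.2 ++ leftmost (subforest F v)).

Definition terminal F (v : address) : bool :=
  (v \in IN F) && [forall j, subforest F (child v j) == leaf].

Definition LTer F : {fset nat} := [fset rho F v | v in IN F & terminal F v].

(* F/i: the tree containing the terminal node v with rho_F(v) = i is cut at v; *)
(* the value when i is not in LTer(F) is irrelevant. *)
Definition trim F (i : nat) : forest m :=
  if [pick v : IN F | terminal F (val v) && (rho F (val v) == i)] is Some v
  then [fsfun F with (val v).1 |-> cut (F (val v).1) (val v).2]
  else F.

(* Membership in C(F). The condition kappa(v) <= kappa(v_j) - j, an           *)
(* inequality between integers, is written without truncated subtraction.     *)
Definition compatible F (kappa : IN F -> nat) : bool :=
  [forall v : IN F,
     [&& kappa v <= rho F (val v),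
         [forall j : 'I_m.+1, forall w : IN F,
            (val w == child (val v) j) ==> (kappa v + j <= kappa w)]
       & kappa v == rho F (val v) %[mod m]]]%N.

(* The elements of C(F) are bounded by the largest rho_F(v), so they are all  *)
(* found among the maps into the following finite type.                       *)
Definition rho_max F : nat := (\max_(v : IN F) rho F (val v))%N.

Definition forest_poly F : pol :=
  \sum_(kappa : {ffun IN F -> 'I_(rho_max F).+1} |
           compatible (fun v => kappa v : nat))
    \prod_(v : IN F) X (kappa v).
End Forests.

(* Main.v *)
Require Import Defs.
From HB Require Import structures.
From mathcomp Require Import all_boot all_algebra.
From mathcomp Require Import finmap zify.
From mathcomp.multinomials Require Import monalg.

Set Implicit Arguments.
Unset Strict Implicit.
Unset Printing Implicit Defensive.

Import GRing.Theory.
Local Open Scope fset_scope.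
Local Open Scope ring_scope.

(** Write C(F) for the set of compatible labelings and, for a threshold i, let
    [gap i] be the strictly increasing map of nat that skips the m values
    i, ..., i + m - 1. A monomial survives the substitution R_i^m exactly when
    its labeling avoids these values, and R_i^m then undoes [gap i]. Hence R_i^m
    turns the forest polynomial of F into the sum of x^lambda over the lambda
    with [gap i] o lambda in C(F), and x_i T_i of the forest polynomial is the
    sum over lambda of x^lambda times
      [gap i.+1 o lambda in C(F)] - [gap i o lambda in C(F)].

    The number of leaves of an (m+1)-ary tree is 1 modulo m, so
    rho(v_j) = rho(v) + j mod m. Under the congruence condition, the inequality
    kappa(v) + j <= kappa(v_j) therefore says only that kappa(v) <= kappa(v_j),
    strictly if j > 0 ([leq_eqmodD]). Since [gap i] is strictly increasing and
    the identity modulo m, every condition but the bound kappa <= rho is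
    insensitive to it. The bound itself is stronger for [gap i] than for
    [gap i.+1], and it fails for the former only at a node v with
    lambda(v) = rho(v) = i. A deepest such node is terminal ([exists_tight]):
    its first internal child would be some v_j with rho(v_j) = i + j, whose
    label [gap i.+1] (lambda(v_j)) is at least i + j, and i + 1, ..., i + m are
    skipped, so j = 0 and v_0 would be a deeper one.

    So if i is not in LTer(F) nothing is left. Otherwise let u be the terminal
    node with rho(u) = i, which is unique ([terminal_inj]). The surviving lambda
    have lambda(u) = i, contributing the factor x_i, and erasing u is a bijection
    from them to C(F/i): cutting F at u fixes the labels rho(v) <= i and lowers
    the other ones, all larger than i + m, by m ([rho_prune]), which is what
    [gap i.+1] undoes ([bounded_prune], [well_ordered_prune]). *)

(** * Positions of leaves in a tree *)

Section TreePositions.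
Variable m : nat.
Implicit Types (t : tree m) (p q : seq 'I_m.+1) (f : {ffun 'I_m.+1 -> tree m}).
Local Open Scope nat_scope.

Definition nleaves t : nat := size (leaves t).

Definition offset f (j : 'I_m.+1) : nat := \sum_(l < m.+1 | l < j) nleaves (f l).

(** A recursive form of the index in [leaves t] of the leftmost leaf below [p], see
    [index_leaves]. *)
Fixpoint pos t p : nat :=
  match p, t with
  | j :: q, node f => offset f j + pos (f j) q
  | _, _ => 0
  end.

Definition cherry : tree m := node [ffun => leaf].

Lemma subtree0 t : subtree t [::] = t.
Proof. by case: t. Qed.

Lemma pos0 t : pos t [::] = 0.
Proof. by case: t. Qed.

Lemma cut0 t : cut t [::] = leaf.
Proof. by case: t. Qed.

Lemma mem_inodes t p : (p \in inodes t) = (subtree t p != leaf).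
Proof.
elim/tree_induction: t p => [|f IHf] [|j q] /=; rewrite ?eqxx //.
rewrite inE /= -IHf; apply/flatten_mapP/idP.
  by move=> [l _ /mapP[q' q'l [-> ->]]].
by move=> qj; exists j; rewrite ?mem_enum //; apply: map_f.
Qed.

Lemma subtree_rcons t p j f : subtree t p = node f -> subtree t (rcons p j) = f j.
Proof.
elim: p t => [|l p IHp] [|g] //=; last exact: IHp.
by rewrite subtree0 => -[->].
Qed.

Lemma nleaves_node f : nleaves (node f) = \sum_(j < m.+1) nleaves (f j).
Proof.
rewrite /nleaves /= size_flatten sumnE 2!big_map big_enum.
by apply: eq_bigr => j _; rewrite size_map.
Qed.

(** Each internal node replaces one leaf by m + 1 leaves. *)
Lemma nleavesE t : nleaves t = 1 + m * size (inodes t).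
Proof.
elim/tree_induction: t => [|f IHf]; first by rewrite muln0.
rewrite nleaves_node (eq_bigr _ (fun j _ => IHf j)) big_split /=.
rewrite sum_nat_const card_ord muln1 -big_distrr /= size_flatten sumnE 2!big_map.
rewrite big_enum mulnS addnA add1n; congr (_ + m * _).
by apply: eq_bigr => j _; rewrite size_map.
Qed.

Lemma nleaves_gt0 t : 0 < nleaves t.
Proof. by rewrite nleavesE. Qed.

Lemma nleaves_cherry : nleaves cherry = m.+1.
Proof.
rewrite nleaves_node (eq_bigr (fun=> 1)); last by move=> j _; rewrite ffunE.
by rewrite sum_nat_const card_ord muln1.
Qed.

(** Besides the congruence modulo m, the exact form shows that the offset is [j]
    itself when the children before [j] are leaves. *)
Lemma offsetE f j :
  offset f j = j + m * \sum_(l < m.+1 | l < j) size (inodes (f l)).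
Proof.
rewrite /offset (eq_bigr _ (fun l _ => nleavesE (f l))) big_split /=.
by rewrite -(big_ord_widen _ (fun=> 1)) ?sum_nat_const ?card_ord ?muln1
  ?big_distrr // ltnW.
Qed.

Lemma offset_lt f (l j : 'I_m.+1) : l < j ->
  offset f l + nleaves (f l) <= offset f j.
Proof.
move=> lj; rewrite /offset (bigD1 l lj) addnC leq_add2l /=.
rewrite big_mkcond [leqRHS]big_mkcond leq_sum // => k _.
by case: ltnP => // kl; rewrite -(inj_eq val_inj) (ltn_trans kl lj) ltn_eqF.
Qed.

Lemma offset_le f j : offset f j + nleaves (f j) <= nleaves (node f).
Proof.
rewrite nleaves_node (bigD1 j) //= addnC leq_add2l /offset.
rewrite big_mkcond [leqRHS]big_mkcond leq_sum // => k _.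
by case: ltnP => // kl; rewrite -(inj_eq val_inj) ltn_eqF.
Qed.

Lemma pos_subtree t p : pos t p + nleaves (subtree t p) <= nleaves t.
Proof.
elim: p t => [t|j p IHp [|f] //=]; first by rewrite pos0 subtree0.
rewrite -addnA.
by apply: leq_trans (offset_le f j); rewrite leq_add2l.
Qed.

Lemma pos_lt t p : pos t p < nleaves t.
Proof.
apply: leq_trans (pos_subtree t p).
by rewrite -addn1 leq_add2l nleaves_gt0.
Qed.

Lemma pos_rcons t p j f : subtree t p = node f ->
  pos t (rcons p j) = pos t p + offset f j.
Proof.
elim: p t => [t|l p IHp [|g] //= e]; last by rewrite IHp // addnA.
by rewrite subtree0 => ->; rewrite /= !pos0 addn0.
Qed.

Lemma leftmost_leaves t : leftmost t \in leaves t.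
Proof.
elim/tree_induction: t => //= f IHf.
by apply/flatten_mapP; exists ord0; rewrite ?mem_enum //; apply: map_f.
Qed.

Lemma mem_leaves t p : p \in inodes t -> p ++ leftmost (subtree t p) \in leaves t.
Proof.
rewrite mem_inodes; elim: p t => [|j p IHp] t.
  by rewrite subtree0 leftmost_leaves.
case: t => //= f pj; apply/flatten_mapP.
by exists j; rewrite ?mem_enum //; apply/map_f/IHp.
Qed.

Lemma index_flatten (g : 'I_m.+1 -> seq (seq 'I_m.+1)) (s : seq 'I_m.+1) j q :
  sorted (fun k l : 'I_m.+1 => k < l) s -> j \in s -> q \in g j ->
  index (j :: q) (flatten [seq [seq l :: r | r <- g l] | l <- s]) =
  \sum_(l <- s | l < j) size (g l) + index q (g j).
Proof.
move=> + + qj; elim: s => //= l s IHs.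
have tr : transitive (fun k l : 'I_m.+1 => k < l).
  by move=> a b c; apply: ltn_trans.
move=> ls; have /allP ltls := order_path_min tr ls.
rewrite index_cat size_map big_cons inE; have [jl|/= nlj js] := eqVneq j l.
  move: qj; rewrite jl => ql _; rewrite ltnn.
  rewrite big_seq_cond big1 ?add0n => [|k /andP[/ltls]]; last lia.
  by rewrite (map_f (cons l)) // (@index_map _ _ (cons l)) // => a b [].
rewrite (ltls j js) ifN; last first.
  by apply/mapP => -[r _ [jl _]]; rewrite jl eqxx in nlj.
by rewrite IHs ?addnA //; apply: path_sorted ls.
Qed.

Lemma index_leaves t p : p \in inodes t ->
  index (p ++ leftmost (subtree t p)) (leaves t) = pos t p.
Proof.
rewrite mem_inodes; elim: p t => [|j p IHp] t.
  move=> _; rewrite subtree0 pos0 cat0s; elim/tree_induction: t => //= f IHf.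
  rewrite index_flatten ?mem_enum ?leftmost_leaves ?IHf //.
    by rewrite big_pred0 // => l; rewrite ltn0.
  by rewrite -(sorted_map (e' := ltn)) val_enum_ord iota_ltn_sorted.
case: t => //= f pj; rewrite index_flatten ?IHp ?mem_enum //.
- by rewrite big_enum_cond.
- by rewrite -(sorted_map (e' := ltn)) val_enum_ord iota_ltn_sorted.
by apply: mem_leaves; rewrite mem_inodes.
Qed.

Lemma nleaves_cut t p : subtree t p = cherry -> nleaves (cut t p) + m = nleaves t.
Proof.
elim: p t => [t|j p IHp [|f] //= e].
  by rewrite subtree0 cut0 => ->; rewrite nleaves_cherry.
rewrite !nleaves_node (bigD1 j) // [RHS](bigD1 j) //= ffunE eqxx -(IHp (f j)) //.
rewrite [LHS]addnAC.
by congr (_ + _); apply: eq_bigr => l lj; rewrite ffunE (negPf lj).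
Qed.

Lemma subtree_cut t p q : subtree t p = cherry ->
  (subtree (cut t p) q != leaf) = (subtree t q != leaf) && (q != p).
Proof.
elim: p t q => [t|j p IHp [|f] //] [|l q] //= e.
- by rewrite cut0 andbF.
- move: e; rewrite cut0 subtree0 => ->; rewrite /= ffunE.
  by case: q.
by rewrite ffunE eqseq_cons; case: (eqVneq l j) => [->|_] /=; rewrite ?andbT // IHp.
Qed.

(** A node to the left of the cherry at [p], or above it, keeps its position; a
    node to the right lies beyond the m + 1 leaves of the cherry, m of which
    disappear. *)
Lemma pos_cut t p q : subtree t p = cherry -> q \in inodes t -> q != p ->
  pos t q <= pos t p /\ pos (cut t p) q = pos t q \/
  pos t p + m < pos t q /\ pos (cut t p) q + m = pos t q.
Proof.
rewrite mem_inodes; elim: p t q => [t|j p IHp [|f] //] [|l q] //=.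
- by rewrite subtree0 => -> /=; rewrite ffunE; case: q.
- by left.
move=> e qf; rewrite eqseq_cons ffunE => nqp.
have eqo (k : 'I_m.+1) : k <= j ->
    offset [ffun x => if x == j then cut (f x) p else f x] k = offset f k.
  move=> kj; apply: eq_bigr => x xk; rewrite ffunE ifN //.
  by rewrite -(inj_eq val_inj) ltn_eqF //; apply: leq_trans kj.
have [lj|jl|/val_inj lj] := ltngtP (val l) (val j).
- have ljF : (l == j) = false by rewrite -(inj_eq val_inj) ltn_eqF.
  rewrite ljF eqo ?(ltnW lj) //; left; split=> //.
  by have := offset_lt f lj; have := pos_lt (f l) q; lia.
- have ljF : (l == j) = false by rewrite -(inj_eq val_inj) gtn_eqF.
  rewrite ljF; right.
  have -> : offset f l = 
      offset [ffun x => if x == j then cut (f x) p else f x] l + m.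
    rewrite /offset (bigD1 j) //= [in RHS](bigD1 j) //= ffunE eqxx.
    rewrite -(nleaves_cut e) [RHS]addnAC; congr (_ + _).
    by apply: eq_bigr => x /andP[_ /negPf xj]; rewrite ffunE xj.
  split; last by rewrite addnAC.
  have := offset_lt [ffun x => if x == j then cut (f x) p else f x] jl.
  rewrite ffunE eqxx eqo // => olt.
  have := pos_subtree (f j) p; rewrite e nleaves_cherry -(nleaves_cut e).
  lia.
move: nqp qf; rewrite lj eqxx /= eqo // => nqp qf.
by have := IHp _ _ e qf nqp; lia.
Qed.

End TreePositions.

(** * The leaf label of a node of a forest *)

Section ForestLabels.
Variable m : nat.
Implicit Types (F : forest m) (u v w : address m).
Local Open Scope nat_scope.

Lemma mem_IN F v : (v \in IN F) = (subforest F v != leaf).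
Proof.
case: v => k p; rewrite /subforest /= -mem_inodes; apply/imfset2P/idP.
  by case=> k' _ [p' p'k [-> ->]].
move=> pk; exists k; last by exists p.
by rewrite /= mem_finsupp; apply: contraTneq pk => ->.
Qed.

Lemma mem_IN_inodes F v : (v \in IN F) = (v.2 \in inodes (F v.1)).
Proof. by rewrite mem_IN mem_inodes. Qed.

Lemma IN_node F v : v \in IN F -> exists f, subforest F v = node f.
Proof. by rewrite mem_IN; case: subforest => [|f] //; exists f. Qed.

Lemma subforest_child F v j f :
  subforest F v = node f -> subforest F (child v j) = f j.
Proof. exact: subtree_rcons. Qed.

Lemma rhoE F v : v \in IN F ->
  rho F v = \sum_(k < v.1) nleaves (F k) + pos (F v.1) v.2.
Proof. by rewrite mem_IN_inodes => vF; rewrite /rho /leaf_label /= index_leaves. Qed.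

Lemma rho_child F v f j : subforest F v = node f -> child v j \in IN F ->
  rho F (child v j) = rho F v + j + m * \sum_(l < m.+1 | l < j) size (inodes (f l)).
Proof.
move=> vf wF; have vF : v \in IN F by rewrite mem_IN vf.
by rewrite !rhoE //= (pos_rcons _ vf) offsetE !addnA.
Qed.

Lemma rho_child_mod F v j : v \in IN F -> child v j \in IN F ->
  rho F (child v j) = rho F v + j %[mod m].
Proof.
move=> /IN_node[f vf] wF.
by rewrite (rho_child vf wF) addnC mulnC modnMDl.
Qed.

Lemma rho_child_le F v j : v \in IN F -> child v j \in IN F ->
  rho F v + j <= rho F (child v j).
Proof. by move=> /IN_node[f vf] wF; rewrite (rho_child vf wF) leq_addr. Qed.

Lemma sum_nleaves_lt F k l : k < l ->
  \sum_(x < k) nleaves (F x) + nleaves (F k) <= \sum_(x < l) nleaves (F x).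
Proof.
move=> kl; rewrite -(big_ord_recr k (fun x => nleaves (F x))) /=.
rewrite (big_ord_widen l (fun x => nleaves (F x)) kl).
rewrite [leqRHS](bigID (fun x : 'I_l => x < k.+1)).
exact: leq_addr.
Qed.

Lemma terminalP F v : reflect (subforest F v = cherry m) (terminal F v).
Proof.
apply: (iffP andP) => [[/IN_node[f vf] /forallP vl]|vc].
  rewrite vf; congr node; apply/ffunP => j; rewrite ffunE.
  by have /eqP := vl j; rewrite (subforest_child _ vf).
split; first by rewrite mem_IN vc.
by apply/forallP => j; rewrite (subforest_child _ vc) ffunE.
Qed.

Lemma rho_lt F v w : v \in IN F -> w \in IN F -> v.1 < w.1 ->
  rho F v < rho F w.
Proof.
move=> vF wF vw; rewrite !rhoE //.
by have := sum_nleaves_lt F vw; have := pos_lt (F v.1) v.2; lia.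
Qed.

(** The leftmost child of a terminal node is a leaf, so a leaf determines at most
    one terminal node. *)
Lemma terminal_inj F v w :
  terminal F v -> terminal F w -> rho F v = rho F w -> v = w.
Proof.
move=> /[dup] /andP[vF _] /terminalP vc /[dup] /andP[wF _] /terminalP wc.
case: (ltngtP v.1 w.1) => [vw|wv|e].
- by have := rho_lt vF wF vw; lia.
- by have := rho_lt wF vF wv; lia.
have lc : leftmost (cherry m) = [:: ord0] by rewrite /= ffunE.
move=> eqr.
have vl : v.2 ++ leftmost (subforest F v) \in leaves (F v.1).
  by apply: mem_leaves; rewrite -mem_IN_inodes.
have wl : w.2 ++ leftmost (subforest F w) \in leaves (F v.1).
  by rewrite e; apply: mem_leaves; rewrite -mem_IN_inodes.
have : v.2 ++ [:: ord0] = w.2 ++ [:: ord0].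
  move: vl wl eqr; rewrite /rho /leaf_label /= vc wc lc -e => vl wl /addnI eqi.
  by rewrite -(nth_index [::] vl) eqi nth_index.
rewrite !cats1 => /rcons_inj[e2].
by move: e e2; case: (v) (w) => [k p] [l q] /= -> ->.
Qed.

End ForestLabels.

(** * Cutting a forest at a terminal node *)

Section Trim.
Variable m : nat.
Implicit Types (F : forest m) (u v w : address m).
Local Open Scope nat_scope.

Definition prune F u : forest m := [fsfun F with u.1 |-> cut (F u.1) u.2].

Lemma trimE F i u : terminal F u -> rho F u = i -> trim F i = prune F u.
Proof.
move=> ut ui; rewrite /trim; case: pickP => [v /andP[vt /eqP vi]|].
  by rewrite /prune (terminal_inj ut vt) // vi.
have /andP[uF _] := ut.
by move=> /(_ [` uF]); rewrite /= ut ui eqxx.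
Qed.

Lemma mem_prune F u v : terminal F u ->
  (v \in IN (prune F u)) = (v \in IN F) && (v != u).
Proof.
move=> /terminalP uc; rewrite !mem_IN /subforest fsfun_withE.
case: v u uc => [k p] [l q] /= uc; rewrite xpair_eqE.
by case: (eqVneq k l) => [->|_] /=; rewrite ?andbT // subtree_cut.
Qed.

Lemma IN_prune F u : terminal F u -> IN (prune F u) = IN F `\ u.
Proof.
by move=> ut; apply/fsetP => v; rewrite mem_prune // !inE andbC.
Qed.

(** No node other than [u] has its label in the range from [rho F u + 1] to
    [rho F u + m]: these are the leaf children of [u]. *)
Lemma rho_prune F u v : terminal F u -> v \in IN F -> v != u ->
  rho F v <= rho F u /\ rho (prune F u) v = rho F v \/
  rho F u + m < rho F v /\ rho (prune F u) v + m = rho F v.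
Proof.
move=> ut vF vu; have /andP[uF _] := ut; have /terminalP uc := ut.
have vF' : v \in IN (prune F u) by rewrite mem_prune ?vF.
rewrite [rho (prune F u) v]rhoE // fsfun_withE.
case: (ltngtP v.1 u.1) => [lt|gt|e].
- left; split; first exact/ltnW/rho_lt.
  rewrite rhoE //; congr (_ + _); apply: eq_bigr => k _.
  by rewrite fsfun_withE ltn_eqF // (ltn_trans _ lt).
- right.
  have E : \sum_(k < v.1) nleaves (prune F u k) + m = \sum_(k < v.1) nleaves (F k).
    rewrite (bigD1 (Ordinal gt)) // [RHS](bigD1 (Ordinal gt)) //=.
    rewrite fsfun_with -(nleaves_cut uc) [LHS]addnAC; congr (_ + _).
    by apply: eq_bigr => k ku; rewrite fsfun_withE ifN.
  rewrite !rhoE // -E; split; last by rewrite addnAC.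
  have := sum_nleaves_lt F gt; rewrite -E.
  have := pos_subtree (F u.1) u.2; rewrite -[subtree _ _]/(subforest F u) uc.
  by rewrite nleaves_cherry; lia.
have -> : \sum_(k < v.1) nleaves (prune F u k) = \sum_(k < v.1) nleaves (F k).
  by apply: eq_bigr => k _; rewrite fsfun_withE -e ltn_eqF.
rewrite !rhoE // e.
have vu2 : v.2 != u.2.
  by apply: contraNneq vu; case: (v) (u) e => [k p] [l q] /= -> ->.
have vi : v.2 \in inodes (F u.1) by rewrite -e -mem_IN_inodes.
by have := pos_cut uc vi vu2; lia.
Qed.

End Trim.

(** * Compatible labelings and gaps *)

Section Labelings.
Variable m : nat.
Implicit Types (F : forest m) (u v w : address m) (kappa lambda : address m -> nat).
Local Open Scope nat_scope.

Definition gap i x := if x < i then x else x + m.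
Definition ungap i x := if x < i then x else x - m.

Lemma gapK i : cancel (gap i) (ungap i).
Proof. by move=> x; rewrite /gap /ungap; case: (ltnP x i) => ?; case: ifP; lia. Qed.

Lemma ungapK i x : (x < i) || (i + m <= x) -> gap i (ungap i x) = x.
Proof. by rewrite /gap /ungap; case: (ltnP x i) => ? /=; case: ifP; lia. Qed.

Lemma gap_mod i x : gap i x = x %[mod m].
Proof. by rewrite /gap; case: ifP => // _; rewrite modnDr. Qed.

Lemma gap_leq i (b : bool) x y : (gap i x + b <= gap i y) = (x + b <= y).
Proof. by rewrite /gap; case: (ltnP x i); case: (ltnP y i); lia. Qed.

Lemma ltn_eqmod x y : x < y -> x = y %[mod m] -> x + m <= y.
Proof.
move=> xy /esym/eqP; rewrite eqn_mod_dvd ?(ltnW xy) // => /dvdn_leq.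
by rewrite subn_gt0 leq_subRL ?(ltnW xy) // addnC; apply.
Qed.

(** If y > x then y - x, congruent to j <= m and positive, is at least j. *)
Lemma leq_eqmodD x y j : j <= m -> y = x + j %[mod m] ->
  (x + j <= y) = (x + (0 < j) <= y).
Proof.
move=> jm e; apply/idP/idP; first by case: j {jm e} => //= j; lia.
move=> xy; rewrite leqNgt; apply/negP => yx.
by have := ltn_eqmod yx e; case: j jm e xy yx => [|j] /=; lia.
Qed.

(** The conditions of C(F) that involve no upper bound. The inequality between
    labels of a node and its [j]-th child is weakened according to
    [leq_eqmodD], so that the predicate is visibly invariant under [gap]. *)
Definition well_ordered F kappa := forall v, v \in IN F ->
  kappa v = rho F v %[mod m] /\
  forall j : 'I_m.+1, child v j \in IN F ->
    kappa v + (0 < j) <= kappa (child v j).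

Definition bounded F kappa := forall v, v \in IN F -> kappa v <= rho F v.

Lemma compatibleP F (k : IN F -> nat) kappa :
  (forall v : IN F, k v = kappa (val v)) ->
  reflect (well_ordered F kappa /\ bounded F kappa) (compatible k).
Proof.
move=> kE; have childE v j : {in IN F, forall w, kappa w = rho F w %[mod m]} ->
    v \in IN F -> child v j \in IN F ->
    (kappa v + j <= kappa (child v j)) = (kappa v + (0 < j) <= kappa (child v j)).
  move=> cong vF wF; apply: leq_eqmodD; first by rewrite -ltnS.
  by rewrite cong // rho_child_mod // -modnDml -cong // modnDml.
apply: (iffP forallP) => [kc|[kw kb] v].
  have cong : {in IN F, forall w, kappa w = rho F w %[mod m]}.
    by move=> v vF; have /and3P[_ _ /eqP] := kc [` vF]; rewrite kE.
  split=> v vF; have /and3P[le /forallP ch _] := kc [` vF].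
    split=> [|j wF]; first exact: cong.
    rewrite -childE //.
    by have /forallP/(_ [` wF]) := ch j; rewrite !kE /= eqxx.
  by rewrite -[kappa v](kE [` vF]).
have vF := valP v; have [cong ch] := kw _ vF.
rewrite kE kb //= cong eqxx andbT; apply/forallP => j.
apply/forallP => w; apply/implyP => /eqP wE.
rewrite (etrans (kE w) (congr1 kappa wE)).
have wF : child (val v) j \in IN F by rewrite -wE; apply: valP.
by rewrite childE ?ch // => x xF; have [] := kw x xF.
Qed.

Lemma eq_well_ordered F kappa lambda : {in IN F, kappa =1 lambda} ->
  well_ordered F kappa -> well_ordered F lambda.
Proof.
move=> e kw v vF; have [c h] := kw v vF; rewrite -e //.
by split=> // j wF; rewrite -e ?h.
Qed.

Lemma gap_well_ordered F i lambda :
  well_ordered F (gap i \o lambda) <-> well_ordered F lambda.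
Proof.
by split=> lw v /lw [] /=; rewrite gap_mod => c h; split=> // j /h;
  rewrite gap_leq.
Qed.

Lemma gapS_bounded F i lambda :
  bounded F (gap i \o lambda) -> bounded F (gap i.+1 \o lambda).
Proof.
move=> lb v /lb /=; apply: leq_trans; rewrite /gap ltnS.
by case: ltngtP => //; lia.
Qed.

(** Where the bound fails for [gap i] but not for [gap i.+1], the label is [i] and
    [rho] is between [i] and [i + m - 1], hence equal to [i] by congruence. The
    deepest node where this happens has only leaf children. *)
Lemma exists_tight F i lambda : well_ordered F lambda ->
  bounded F (gap i.+1 \o lambda) -> ~ bounded F (gap i \o lambda) ->
  exists u, [/\ terminal F u, rho F u = i & lambda u = i].
Proof.
move=> lw lb nlb.
pose tight (v : IN F) := (rho F (val v) == i) && (lambda (val v) == i).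
have /existsP[v0 tight0] : [exists v, tight v].
  apply/contraT => /existsPn nt; case: nlb => v vF /=.
  have := nt [` vF]; have := lb v vF; have [c _] := lw v vF.
  have : lambda v < rho F v -> lambda v + m <= rho F v by move/ltn_eqmod; apply.
  rewrite /tight /= /gap ltnS; case: (ltngtP (lambda v) i) => // ->.
  by rewrite andbT; case: ltngtP => // ? /(_ isT).
case: (arg_maxnP (fun v : IN F => size (val v).2) tight0).
move=> u /andP[/eqP ui /eqP li] umax; exists (val u); split=> //; apply/terminalP.
have uF := valP u; have [f uf] := IN_node uF.
rewrite uf; congr node; apply/ffunP => j; rewrite ffunE.
(* By strong induction on j, the children before the j-th one are leaves. *)
have [n] := ubnP (val j); elim: n j => // n IHn j; rewrite ltnS => jn.
apply/eqP/contraT => fj.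
have wF : child (val u) j \in IN F by rewrite mem_IN (subforest_child _ uf).
have := rho_child uf wF; rewrite big1 ?muln0 ?addn0 ?ui; last first.
  by move=> l lj; rewrite IHn // (leq_trans lj jn).
(* The label of the j-th child is squeezed: at least i by the order condition, *)
(* and at most i because [gap i.+1] of it is at most i + j <= i + m.           *)
move=> wi; have [_ /(_ j wF)] := lw _ uF; rewrite li => lt.
have := lb _ wF; rewrite /= /gap ltnS wi.
have := ltn_ord j; case: (leqP (lambda _) i) => [wle jm _|]; last by lia.
have j0 : j = 0 :> nat by move: lt; case: (nat_of_ord j) => //= ?; lia.
have : tight [` wF].
  rewrite /tight /= wi j0 addn0 eqxx /= eqn_leq wle /=.
  by apply: leq_trans lt; apply: leq_addr.
by move=> /umax /=; rewrite size_rcons ltnn.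
Qed.

Lemma tight_unbounded F i lambda u : 0 < m -> u \in IN F -> rho F u = i ->
  lambda u = i -> ~ bounded F (gap i \o lambda).
Proof. by move=> m_gt0 uF ui li /(_ u uF); rewrite /= /gap li ui ltnn; lia. Qed.

(** The labels rho of F are those of F/i moved by [gap i.+1], where i = rho(u),
    and [gap i.+1] is monotone. *)
Lemma bounded_prune F u lambda : terminal F u -> lambda u = rho F u ->
  bounded F (gap (rho F u).+1 \o lambda) <-> bounded (prune F u) lambda.
Proof.
move=> ut lu; split=> lb v vF /=.
  move: vF; rewrite mem_prune // => /andP[vF vu].
  have := lb v vF; have := rho_prune ut vF vu; rewrite /= /gap ltnS.
  by case: (leqP (lambda v) (rho F u)); lia.
have [->|vu] := eqVneq v u; first by rewrite lu /gap ltnS leqnn.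
have := lb v; rewrite mem_prune // vF vu => /(_ isT).
have := rho_prune ut vF vu; rewrite /= /gap ltnS.
by case: (leqP (lambda v) (rho F u)); lia.
Qed.

Lemma rho_prune_mod F u v : terminal F u -> v \in IN F -> v != u ->
  rho (prune F u) v = rho F v %[mod m].
Proof.
by move=> ut vF vu; have [[_ ->]|[_ <-]] := rho_prune ut vF vu;
  rewrite ?modnDr.
Qed.

(** The condition at [u] and its parent is automatic: a parent v with u = v_j has
    lambda(v) <= rho(v) <= rho(u) - j. *)
Lemma well_ordered_prune F u lambda : terminal F u -> lambda u = rho F u ->
  bounded (prune F u) lambda ->
  well_ordered F lambda <-> well_ordered (prune F u) lambda.
Proof.
move=> ut lu lb; have /andP[uF _] := ut; have /terminalP uc := ut.
split=> lw v.
  rewrite mem_prune // => /andP[vF vu]; have [c h] := lw v vF.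
  split=> [|j]; first by rewrite rho_prune_mod.
  by rewrite mem_prune // => /andP[wF _]; apply: h.
have [-> _|vu vF] := eqVneq v u.
  rewrite lu; split=> // j.
  by rewrite mem_IN (subforest_child _ uc) ffunE eqxx.
have vF' : v \in IN (prune F u) by rewrite mem_prune ?vF.
have [c h] := lw v vF'; split=> [|j wF]; first by rewrite c rho_prune_mod.
have [wu|wu] := eqVneq (child v j) u; last by apply: h; rewrite mem_prune ?wF.
have := rho_child_le vF wF; have := lb v vF'; have := rho_prune ut vF vu.
by rewrite wu lu; case: j {wF wu h} => [[|j] jm] /=; lia.
Qed.

End Labelings.

(** * Sums over labelings *)

Lemma sum_bij (V : nmodType) (I J : finType) (P : pred I) (Q : pred J)
    (h : J -> I) (h' : I -> J) (E : I -> V) (G : J -> V) :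
  (forall j, Q j -> [/\ P (h j), h' (h j) = j & E (h j) = G j]) ->
  (forall i, P i -> Q (h' i) /\ h (h' i) = i) ->
  \sum_(i | P i) E i = \sum_(j | Q j) G j.
Proof.
move=> hQ hP; rewrite (reindex_onto h h') => [|i /hP[]//].
have PQ j : P (h j) && (h' (h j) == j) -> Q j by case/andP=> /hP[Qj _] /eqP <-.
apply: eq_big => j; last by move/PQ/hQ => [].
by apply/idP/idP => [/PQ | /hQ[-> -> _]] //; apply: eqxx.
Qed.

Section Sums.
(* Keeps conversion from unfolding polynomials. *)
#[local] Opaque psubst X R.
Variable m : nat.
Implicit Types (F : forest m).

(** A labeling of a finite set of nodes as a function on all addresses, so that
    labelings of F and of F/i can be compared. *)
Definition labels (A : {fset address m}) N (d : nat) (k : {ffun A -> 'I_N})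
    (v : address m) : nat :=
  if insub v is Some w then k w else d.

Lemma labels_val (A : {fset address m}) N d (k : {ffun A -> 'I_N}) (v : A) :
  labels d k (val v) = k v.
Proof. by rewrite /labels valK. Qed.

Lemma labels_notin (A : {fset address m}) N d (k : {ffun A -> 'I_N}) v :
  v \notin A -> labels d k v = d.
Proof. by move=> vA; rewrite /labels insubN. Qed.

Lemma bounded_rho_max F kappa (v : IN F) :
  bounded F kappa -> (kappa (val v) <= rho_max F)%N.
Proof.
move=> kb; apply: leq_trans (kb _ (valP v)) _.
exact: (leq_bigmax (F := fun v : IN F => rho F (val v))).
Qed.

Lemma compatible_rho_max F (k : IN F -> nat) v :
  compatible k -> (k v <= rho_max F)%N.
Proof.
move=> /forallP/(_ v)/and3P[le _ _]; apply: leq_trans le _.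
exact: (leq_bigmax (F := fun v : IN F => rho F (val v))).
Qed.

Lemma eq_compatible F (k l : IN F -> nat) : k =1 l -> compatible k = compatible l.
Proof.
move=> kl; apply: eq_forallb => v; rewrite kl; congr [&& _, _ & _].
by apply: eq_forallb => j; apply: eq_forallb => w; rewrite kl.
Qed.

(** The labelings that take a value skipped by [gap i] contribute zero, and the
    other ones are the [gap i] o lambda. As x <= [gap i] x, the same finite range
    of values serves for lambda. *)
Lemma iter_R_forest_poly F i :
  iter m (R i) (forest_poly F) =
  \sum_(lambda : {ffun IN F -> 'I_(rho_max F).+1} |
         compatible (fun v => gap m i (lambda v)))
    \prod_(v : IN F) X (lambda v).
Proof.
pose avoid (k : {ffun IN F -> 'I_(rho_max F).+1}) :=
  [forall v, (k v < i) || (i + m <= k v)]%N.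
rewrite iter_RE /forest_poly rmorph_sum (bigID avoid) /= [X in _ + X]big1 ?addr0.
  pose move_by (g : nat -> nat) (k : {ffun IN F -> 'I_(rho_max F).+1}) :
    {ffun IN F -> 'I_(rho_max F).+1} := [ffun v => inord (g (k v))].
  apply: (sum_bij (h := move_by (gap m i)) (h' := move_by (ungap m i))) => [l lc|k].
    have lE v : (inord (gap m i (l v)) : 'I_(rho_max F).+1) = gap m i (l v) :> nat.
      by rewrite inordK // ltnS (compatible_rho_max v lc).
    split.
    - apply/andP; split.
        by rewrite (eq_compatible (l := fun v => gap m i (l v))) // => v;
          rewrite ffunE lE.
      by apply/forallP => v; rewrite ffunE lE /gap; case: (ltnP (l v) i); lia.
    - by apply/ffunP => v; rewrite !ffunE lE gapK inord_val.
    rewrite rmorph_prod /=; apply: eq_bigr => v _.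
    rewrite psubstX iter_RX ffunE lE /gap; case: (ltnP (l v) i) => [->//|li].
    by rewrite ltn_add2r addnK !ltnNge li (leq_trans li) ?leq_addr.
  move=> /andP[kc /forallP ka].
  have kE v : (inord (ungap m i (k v)) : 'I_(rho_max F).+1) = ungap m i (k v) :> nat.
    by rewrite inordK // ltnS /ungap; case: ifP; have := ltn_ord (k v); lia.
  split; last first.
    by apply/ffunP => v; rewrite !ffunE kE ungapK ?inord_val.
  by rewrite (eq_compatible (l := fun v => k v : nat)) // => v;
    rewrite ffunE kE ungapK.
move=> k /andP[_ /forallPn[v]]; rewrite negb_or -!leqNgt -ltnNge => /andP[ik ki].
have z : psubst (fun j => iter m (R i) (X j)) (X (k v)) = 0.
  by rewrite psubstX iter_RX ltnNge ik ki.
by rewrite (bigD1 v isT) rmorphM /= z mul0r.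
Qed.

(** If [gap i] o lambda is compatible then so is [gap i.+1] o lambda, hence the
    difference of the two sums has no negative terms. *)
Lemma T_forest_poly F i :
  X i * T m i (forest_poly F) =
  \sum_(lambda : {ffun IN F -> 'I_(rho_max F).+1} |
         compatible (fun v => gap m i.+1 (lambda v)) &&
         ~~ compatible (fun v => gap m i (lambda v)))
    \prod_(v : IN F) X (lambda v).
Proof.
apply: etrans (TE m i (forest_poly F)) _.
apply: etrans (congr2 (fun a b : pol => a - b)
  (iter_R_forest_poly F i.+1) (iter_R_forest_poly F i)) _.
apply/eqP; rewrite subr_eq; apply/eqP.
rewrite (bigID (fun l : {ffun IN F -> 'I_(rho_max F).+1} =>
                  compatible (fun v => gap m i (l v)))) /= addrC.
congr (_ + _).
apply: eq_bigl => l; apply: andb_idl.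
have lE j v : gap m j (l v) = (gap m j \o labels 0 l) (val v).
  by rewrite /= labels_val.
move=> /(compatibleP (lE i))[/gap_well_ordered lw /gapS_bounded lb].
by apply/(compatibleP (lE i.+1)); split=> //; apply/gap_well_ordered.
Qed.

(** A gap affects only the bound, so a labeling survives in the difference
    exactly when it is tight at some terminal node. *)
Lemma new_labelingP F i (k : {ffun IN F -> 'I_(rho_max F).+1}) : (0 < m)%N ->
  reflect (let lambda := labels 0 k in
           [/\ well_ordered F lambda, bounded F (gap m i.+1 \o lambda) &
            exists u, [/\ terminal F u, rho F u = i & lambda u = i]])
   (compatible (fun v => gap m i.+1 (k v)) &&
    ~~ compatible (fun v => gap m i (k v))).
Proof.
move=> m_gt0; have kE j v : gap m j (k v) = (gap m j \o labels 0 k) (val v).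
  by rewrite /= labels_val.
apply: (iffP andP) => /= [[/(compatibleP (kE i.+1))[/gap_well_ordered kw kb]]|].
  move=> /(compatibleP (kE i)) nk; split=> //.
  apply: exists_tight => // kb'; apply: nk; split=> //.
  exact/gap_well_ordered.
move=> [kw kb [u [ut ui ki]]]; have /andP[uF _] := ut; split.
  by apply/(compatibleP (kE i.+1)); split=> //; apply/gap_well_ordered.
apply/(compatibleP (kE i)) => -[_].
exact: tight_unbounded m_gt0 uF ui ki.
Qed.

(** The bijection restricts a labeling of F to F/i, and extends a labeling of F/i
    by the value rho(u) at u. *)
Lemma sum_new_labelings F u : (0 < m)%N -> terminal F u ->
  \sum_(lambda : {ffun IN F -> 'I_(rho_max F).+1} |
         compatible (fun v => gap m (rho F u).+1 (lambda v)) &&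
         ~~ compatible (fun v => gap m (rho F u) (lambda v)))
    \prod_(v : IN F) X (lambda v) = X (rho F u) * forest_poly (prune F u).
Proof.
move=> m_gt0 ut; have /andP[uF _] := ut.
set i := rho F u; set F' := prune F u.
have uF' : u \notin IN F' by rewrite mem_prune // eqxx andbF.
have F'F v : v \in IN F' -> v \in IN F by rewrite mem_prune // => /andP[].
have i_max : (i <= rho_max F)%N.
  exact: (leq_bigmax (F := fun v : IN F => rho F (val v)) [` uF]).
rewrite /forest_poly big_distrr /=.
pose extend (l : {ffun IN F' -> 'I_(rho_max F').+1}) :
  {ffun IN F -> 'I_(rho_max F).+1} := [ffun v => inord (labels i l (val v))].
pose restrict (k : {ffun IN F -> 'I_(rho_max F).+1}) :
  {ffun IN F' -> 'I_(rho_max F').+1} := [ffun v => inord (labels 0 k (val v))].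
apply: (sum_bij (h := extend) (h' := restrict)) => [l|k].
  have lE v : (l v : nat) = labels i l (val v) by rewrite labels_val.
  move=> /(compatibleP lE)[lw lb].
  have lu : labels i l u = i by rewrite labels_notin.
  have lb' : bounded F (gap m i.+1 \o labels i l).
    exact: (proj2 (bounded_prune ut lu) lb).
  have lw' : well_ordered F (labels i l).
    exact: (proj2 (well_ordered_prune ut lu lb) lw).
  have hE v : v \in IN F ->
      (inord (labels i l v) : 'I_(rho_max F).+1) = labels i l v :> nat.
    move=> vF; rewrite inordK // ltnS.
    apply: leq_trans (bounded_rho_max [` vF] lb') => /=.
    by rewrite /gap; case: ifP; lia.
  set k := extend l.
  have kE : {in IN F, labels i l =1 labels 0 k}.
    by move=> v vF; rewrite (labels_val 0 k [` vF]) ffunE /= hE.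
  split.
  - apply/(new_labelingP _ _ m_gt0); split.
    + exact: eq_well_ordered lw'.
    + by move=> v vF; rewrite /= -kE //; apply: lb'.
    by exists u; rewrite -kE.
  - apply/ffunP => v; have vF := F'F _ (valP v).
    by rewrite ffunE -kE // labels_val inord_val.
  transitivity (\prod_(v <- IN F) X (labels i l v)).
    by rewrite big_seq_fsetE /=; apply: eq_bigr => v _; rewrite ffunE hE ?fsvalP.
  rewrite (big_fsetD1 u uF) lu -(IN_prune ut) big_seq_fsetE.
  apply: (congr1 (fun a : pol => X i * a)).
  by apply: eq_bigr => v _; rewrite labels_val.
move=> /(new_labelingP _ _ m_gt0)[kw kb [u' [ut' ui' ku]]].
have {u' ut' ui'} ku : labels 0 k u = i by rewrite -(terminal_inj ut' ut ui').
have kb' : bounded F' (labels 0 k).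
  exact: (proj1 (bounded_prune ut ku) kb).
have kw' : well_ordered F' (labels 0 k).
  exact: (proj1 (well_ordered_prune ut ku kb') kw).
have kE (v : IN F') :
    (inord (labels 0 k (val v)) : 'I_(rho_max F').+1) = labels 0 k (val v) :> nat.
  by rewrite inordK // ltnS bounded_rho_max.
set l := restrict k.
have lE v : (l v : nat) = labels 0 k (val v) by rewrite ffunE kE.
split; first exact/(compatibleP lE).
apply/ffunP => v; rewrite ffunE -[RHS]inord_val -(labels_val 0 k); congr inord.
have [vu|vu] := eqVneq (val v) u; first by rewrite vu ku labels_notin.
have vF' : val v \in IN F' by rewrite mem_prune // vu andbT; apply: valP.
by rewrite (labels_val i l [` vF']) lE.
Qed.

End Sums.

Theorem theoremA14 (m : nat) (hm : (0 < m)%N) (F : forest m) (i : nat) :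
  T m i (forest_poly F) = if i \in LTer F then forest_poly (trim F i) else 0.
Proof.
apply: (@X_inj i); rewrite T_forest_poly //.
case: ifPn => [/imfsetP[u /= /andP[_ ut] ->]|niF].
  by rewrite (trimE ut erefl) sum_new_labelings.
rewrite mulr0 big_pred0 // => l; apply: contraNF niF.
move=> /(new_labelingP _ _ hm)[_ _ [u [ut <- _]]].
by apply/imfsetP; exists u => //; rewrite !inE ut andbT; case/andP: ut.
Qed.
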